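(* Let $(\Delta,[\![\ ,\ ]\!])$ be a regular cleft extension on a differential graded algebra $\Omega=\Omega(A)$ of classical type. Then the extended covariant derivative $\nabla_\omega:=\frac12[\![\omega,\ ]\!]$ on $\Omega$, $\omega\in\Omega$, has degree $|\omega|-1$ and obeys $$\nabla_{a\omega}=a\nabla_\omega,\qquad\nabla_\omega(a\eta)=a\nabla_\omega\eta+\mathfrak j_\omega(\mathrm da)\eta,\qquad\nabla_1\eta=\nabla_\omega1=0,$$ $$\tfrac12L_\Delta(\omega,\ )=\big(\mathrm d\nabla_\omega+(-1)^{|\omega|}\nabla_\omega\mathrm d\big)+\nabla_{\mathrm d\omega},\qquad\forall a\in A,\ \omega,\eta\in\Omega.$$ If the metric inner product $(\ ,\ )$ is invertible and $\nabla_\omega$ is a derivation for all $\omega\in\Omega^1$, then $\nabla_\omega$ is a graded derivation (of degree $|\omega|-1$) for all $\omega\in\Omega$ and $$\nabla_{\omega_1\cdots\omega_m}=\sum_{i=1}^m(-1)^{i-1}\omega_1\cdots\widehat{\omega_i}\cdots\omega_m\nabla_{\omega_i},\qquad\forall\omega_i\in\Omega^1,$$ where the hat denotes omission.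
   Context: $A$ is a unital algebra over a field $k$ of characteristic $\ne2$. A DGA on $A$ is an associative graded algebra $\Omega=\oplus_{n\ge0}\Omega^n$ with $\Omega^0=A$ and a graded derivation $\mathrm d$ of degree $1$, $\mathrm d^2=0$. It is standard if $\Omega^1$ is spanned by elements $a\,\mathrm db$ and $\Omega$ is generated by degrees $0,1$; of classical type if it is standard, graded-commutative and equal to the tensor algebra of $\Omega^1$ over $A$ modulo the relations of antisymmetry. $L_\Delta(\omega,\eta)=\Delta(\omega\eta)-(\Delta\omega)\eta-\omega\Delta\eta$. A (central extension) cocycle on $\Omega$ is a pair of a degree $0$ linear map $\Delta$ and a degree $-1$ bilinear map $[\![\ ,\ ]\!]$ on $\Omega$ with $[\Delta,\mathrm d]=0$ and, for all $\omega,\eta,\zeta\in\Omega$, $[\![\omega\eta,\zeta]\!]+[\![\omega,\eta]\!]\zeta=[\![\omega,\eta\zeta]\!]+(-1)^{|\omega|}\omega[\![\eta,\zeta]\!]$ and $L_\Delta(\omega,\eta)=\mathrm d[\![\omega,\eta]\!]+[\![\mathrm d\omega,\eta]\!]+(-1)^{|\omega|}[\![\omega,\mathrm d\eta]\!]$. It is a cleft extension if $[\![a,\ ]\!]=0$ for all $a\in A$. A cleft extension is regular if $\mathfrak j_\omega(a\,\mathrm db)=\frac12[\![\omega a,b]\!]$ is a well-defined map $\mathfrak j:\Omega^i\otimes_A\Omega^1\to\Omega^{i-1}$ for all $i$; the metric inner product is $(\omega,\zeta)=\mathfrak j_\omega(\zeta)$ for $\omega,\zeta\in\Omega^1$. It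 is invertible if there is $g=g^1\otimes g^2\in\Omega^1\otimes_A\Omega^1$ (sum understood) with $(\omega,g^1)g^2=\omega=g^1(g^2,\omega)$ for all $\omega\in\Omega^1$. A graded derivation $B$ of degree $d$ satisfies $B(\eta\zeta)=(B\eta)\zeta+(-1)^{d|\eta|}\eta B\zeta$. *)

(* Defs.v *)
From HB Require Import structures.
From mathcomp Require Import all_boot all_algebra.
From mathcomp Require Import boolp.
From mathcomp.multinomials Require Import freeg.

Set Implicit Arguments.
Unset Strict Implicit.
Unset Printing Implicit Defensive.

Import GRing.Theory.
Local Open Scope ring_scope.
Local Open Scope quotient_scope.

Section Presented.

Definition generated (V : zmodType) (P : V -> Prop) : {pred V} := fun x =>
  `[< forall S : {pred V}, zmod_closed S -> (forall y, P y -> y \in S) ->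
      x \in S >].

Lemma generated_zmod_closed (V : zmodType) (P : V -> Prop) :
  zmod_closed (generated P).
Proof.
split=> [|x y /asboolP xP /asboolP yP]; apply/asboolP => S clS PS.
  by case: clS.
by case: (clS) => _; apply; [apply: xP | apply: yP].
Qed.

HB.instance Definition _ (V : zmodType) (P : V -> Prop) :=
  GRing.isZmodClosed.Build V (generated P) (generated_zmod_closed P).

Variables (X : choiceType) (rel : {freeg X / int} -> Prop).

Definition presented : zmodType := {ideal_quot (generated rel)}.

Definition pgen (x : X) : presented :=
  \pi_({ideal_quot (generated rel)}) << x >>.

End Presented.

Arguments pgen {X rel} x.

Record grAlg (k : fieldType) := GrAlg {
  gr_alg :> algType k;
  grade : nat -> submodClosed gr_alg;
  grade1 : 1 \in grade 0;
  gradeM : forall i j x y,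
    x \in grade i -> y \in grade j -> x * y \in grade (i + j)%N;
  grade_span : forall x : gr_alg, exists (n : nat) (f : nat -> gr_alg),
    (forall i, f i \in grade i) /\ x = \sum_(i < n) f i;
  grade_direct : forall (n : nat) (f : nat -> gr_alg),
    (forall i, f i \in grade i) -> \sum_(i < n) f i = 0 ->
    forall i, (i < n)%N -> f i = 0
}.

Section GradedMaps.

Variables (k : fieldType) (Om : grAlg k).

Definition gradeZ (z : int) : {pred Om} :=
  if z is Posz n then mem (grade Om n) else pred1 0.

Definition has_degree (e : int) (f : Om -> Om) :=
  forall (n : nat) (x : Om), x \in grade Om n -> f x \in gradeZ (e + n%:Z).

Definition graded_derivation (e : int) (B : Om -> Om) :=
  [/\ linear B, has_degree e B &
      forall (n : nat) (x y : Om), x \in grade Om n ->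
        B (x * y) = B x * y + (-1 : k) ^ (e * n%:Z) *: (x * B y)].

Definition graded_commutative :=
  forall (i j : nat) (x y : Om), x \in grade Om i -> y \in grade Om j ->
    x * y = (-1) ^+ (i * j)%N * (y * x).

Record hform (n : nat) := HForm {
  hform_val :> Om;
  hformP : hform_val \in grade Om n
}.

HB.instance Definition _ n := [isSub for @hform_val n].
HB.instance Definition _ n := [Choice of hform n by <:].
HB.instance Definition _ n := [SubChoice_isSubLmodule of hform n by <:].

End GradedMaps.

Arguments gradeZ {k} Om z.

Record dga (k : fieldType) (A : algType k) := Dga {
  dga_gr :> grAlg k;
  inc : {lrmorphism A -> dga_gr};
  inc_inj : injective inc;
  inc_im : forall x, x \in grade dga_gr 0 <-> exists a, x = inc a;
  dd : {linear dga_gr -> dga_gr};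
  dd_der : graded_derivation 1 dd;
  dd_dd : forall x, dd (dd x) = 0
}.

Arguments inc {k A Om} : rename.
Arguments dd {k A Om} : rename.

Section Dga.

Variables (k : fieldType) (A : algType k) (Om : dga A).

Lemma inc_grade (a : A) : inc a \in grade Om 0.
Proof. by apply/inc_im; exists a. Qed.

Lemma lact_subproof n (a : A) (w : hform Om n) :
  inc a * (w : Om) \in grade Om n.
Proof. exact: gradeM (inc_grade a) (hformP w). Qed.

Lemma ract_subproof n (w : hform Om n) (a : A) :
  (w : Om) * inc a \in grade Om n.
Proof. by have := gradeM (hformP w) (inc_grade a); rewrite addn0. Qed.

Lemma dd_subproof (b : A) : dd (inc b) \in grade Om 1.
Proof. by have [_ /(_ 0%N _ (inc_grade b))] := dd_der Om. Qed.

Definition lact n a (w : hform Om n) := HForm (lact_subproof a w).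
Definition ract n (w : hform Om n) a := HForm (ract_subproof w a).
Definition dform (b : A) := HForm (dd_subproof b).

Definition standard :=
  (forall w : hform Om 1, exists s : seq (A * A),
     w = \sum_(p <- s) lact p.1 (dform p.2)) /\
  (forall S : {pred Om}, subalg_closed S ->
     {subset grade Om 0 <= S} -> {subset grade Om 1 <= S} ->
     forall x, x \in S).

(* Scalars from k act through A, so presenting the tensor products over A as  *)
(* abelian groups loses nothing.                                              *)
Inductive tens_rel (i j : nat) :
    {freeg (hform Om i * hform Om j) / int} -> Prop :=
| TensAddl w w' z :
    tens_rel (<< (w + w', z) >> - << (w, z) >> - << (w', z) >>)
| TensAddr w z z' :
    tens_rel (<< (w, z + z') >> - << (w, z) >> - << (w, z') >>)
| TensBal w a z :
    tens_rel (<< (ract w a, z) >> - << (w, lact a z) >>).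

Definition tens (i j : nat) : zmodType := presented (@tens_rel i j).

Definition tensor i j (w : hform Om i) (z : hform Om j) : tens i j :=
  pgen (w, z).

(* The tensor algebra of Omega^1 over A modulo antisymmetry. A generator      *)
(* (a, [:: v1; ..; vn]) stands for a (v1 (x) .. (x) vn), of degree n.         *)
(* In AntiSym the element (u (x) v + v (x) u) is multiplied on the left by    *)
(* (a, s) and on the right by c t, so that these relators span the two-sided  *)
(* ideal.                                                                     *)
Inductive talg_rel : {freeg (A * seq (hform Om 1)) / int} -> Prop :=
| TalgAdd0 a b s :
    talg_rel (<< (a + b, s) >> - << (a, s) >> - << (b, s) >>)
| TalgAdd a s u v t :
    talg_rel (<< (a, s ++ (u + v) :: t) >>
              - << (a, s ++ u :: t) >> - << (a, s ++ v :: t) >>)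
| TalgBal0 a c u t :
    talg_rel (<< (a * c, u :: t) >> - << (a, lact c u :: t) >>)
| TalgBal a s u c v t :
    talg_rel (<< (a, s ++ ract u c :: v :: t) >>
              - << (a, s ++ u :: lact c v :: t) >>)
| AntiSym a s u v c t :
    talg_rel (<< (a, s ++ u :: ract v c :: t) >>
              + << (a, s ++ v :: ract u c :: t) >>).

Definition antisym_talg : zmodType := presented talg_rel.

(* The product of antisym_talg is concatenation of tensors, so an additive    *)
(* phi as below is automatically an isomorphism of graded algebras.           *)
Definition classical_type :=
  [/\ standard, graded_commutative Om &
      exists phi : {additive antisym_talg -> Om}, bijective phi /\
        forall a (s : seq (hform Om 1)),
          phi (pgen (a, s)) = inc a * \prod_(v <- s) (v : Om)].

Definition Leibnizator (Delta : Om -> Om) (w e : Om) :=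
  Delta (w * e) - Delta w * e - w * Delta e.

Record cocycle (Delta : {linear Om -> Om}) (br : {bilinear Om -> Om -> Om}) :
    Prop := Cocycle {
  Delta_degree : has_degree 0 Delta;
  br_degree : forall (i j : nat) (w e : Om),
    w \in grade Om i -> e \in grade Om j ->
    br w e \in gradeZ Om (i%:Z + j%:Z - 1);
  Delta_dd : forall w, Delta (dd w) = dd (Delta w);
  br_cocycle : forall (i : nat) (w e z : Om), w \in grade Om i ->
    br (w * e) z + br w e * z = br w (e * z) + (-1) ^+ i * (w * br e z);
  Delta_br : forall (i : nat) (w e : Om), w \in grade Om i ->
    Leibnizator Delta w e
    = dd (br w e) + br (dd w) e + (-1) ^+ i * br w (dd e)
}.

Definition cleft (br : {bilinear Om -> Om -> Om}) :=
  forall (a : A) (e : Om), br (inc a) e = 0.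

(* jj i is the map w (x) z |-> j_w(z) on Omega^i (x)_A Omega^1; the formula   *)
(* determines it when Omega is standard.                                      *)
Record regular (br : {bilinear Om -> Om -> Om})
    (jj : forall i, {additive tens i 1 -> Om}) : Prop := Regular {
  jj_degree : forall i (t : tens i 1), jj i t \in gradeZ Om (i%:Z - 1);
  jjE : forall i (w : hform Om i) (a b : A),
    jj i (tensor w (lact a (dform b))) = 2^-1 *: br ((w : Om) * inc a) (inc b)
}.

Definition metric (jj : forall i, {additive tens i 1 -> Om})
  (w z : hform Om 1) : Om := jj 1%N (tensor w z).

Definition metric_invertible (jj : forall i, {additive tens i 1 -> Om}) :=
  exists (g : tens 1 1) (s : seq (hform Om 1 * hform Om 1)),
    g = \sum_(p <- s) tensor p.1 p.2 /\
    forall w : hform Om 1,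
      \sum_(p <- s) metric jj w p.1 * (p.2 : Om) = (w : Om) /\
      \sum_(p <- s) (p.1 : Om) * metric jj p.2 w = (w : Om).

Definition nabla (br : {bilinear Om -> Om -> Om}) (w e : Om) : Om :=
  2^-1 *: br w e.

End Dga.

(* Main.v *)
Require Import Defs.
From mathcomp Require Import all_boot all_algebra.
From mathcomp Require Import boolp.

(** The cocycle identity at a one-form [w] for which [nabla w] is a derivation
    becomes [nabla (w p) = p nabla w - w nabla p].  Iterating it gives the
    formula on products of one-forms and shows that [nabla] of such a product
    is a graded derivation; as these products span over [A], so is every
    [nabla w]. *)

Set Implicit Arguments.
Unset Strict Implicit.
Unset Printing Implicit Defensive.

Import GRing.Theory.
Local Open Scope ring_scope.

(** Signs occur both as elements of the algebra, in graded commutativity and the cocycle identity,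
    and as scalars of [k], in [graded_derivation]; this passes between the two. *)
Lemma mulr_signZ (k : fieldType) (V : algType k) n (x : V) :
  (-1) ^+ n * x = (-1 : k) ^+ n *: x.
Proof. by rewrite -signr_odd -[in RHS]signr_odd mulr_sign scaler_sign. Qed.

(** * Spanning by monomials in one-forms *)

Section Span.

Variables (k : fieldType) (A : algType k) (Om : dga A).

Definition prod1 (v : seq (hform Om 1)) : Om := \prod_(u <- v) (u : Om).

Lemma prod1_cons u v : prod1 (u :: v) = (u : Om) * prod1 v.
Proof. exact: big_cons. Qed.

Lemma prod1_grade v : prod1 v \in grade Om (size v).
Proof.
elim: v => [|u v IHv]; first by rewrite /prod1 big_nil grade1.
by rewrite prod1_cons; apply: (gradeM (hformP u) IHv).
Qed.

Definition monom (p : A * seq (hform Om 1)) : Om := inc p.1 * prod1 p.2.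

Lemma monom_grade p : monom p \in grade Om (size p.2).
Proof. exact: (gradeM (inc_grade Om p.1) (prod1_grade p.2)). Qed.

Hypotheses (Om_std : standard Om) (Om_comm : graded_commutative Om).

Lemma inc_comm (a : A) n (x : Om) :
  x \in grade Om n -> x * inc a = inc a * x.
Proof.
by move=> xn; rewrite (Om_comm xn (inc_grade Om a)) muln0 expr0 mul1r.
Qed.

Lemma monomM p q : monom p * monom q = monom (p.1 * q.1, p.2 ++ q.2).
Proof.
rewrite /monom /prod1 /= rmorphM big_cat /= !mulrA -(mulrA _ _ (inc q.1)).
by rewrite (inc_comm _ (prod1_grade p.2)) !mulrA.
Qed.

(** By [monomM] the sums of monomials form a subalgebra; it contains degrees 0 and 1, which generate
    [Om]. *)
Lemma monom_span (x : Om) : exists s, x = \sum_(p <- s) monom p.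
Proof.
pose S : {pred Om} := fun x => `[< exists s, x = \sum_(p <- s) monom p >].
suff /asboolP : x \in S by [].
apply: (proj2 Om_std) => {x} [|x /inc_im [a ->]|x x1].
- split=> [|c x y|x y].
  + apply/asboolP; exists [:: (1, [::])].
    by rewrite big_seq1 /monom /prod1 big_nil rmorph1 mulr1.
  + move=> /asboolP [s ->] /asboolP [t ->]; apply/asboolP.
    exists ([seq (c *: p.1, p.2) | p <- s] ++ t).
    rewrite big_cat big_map /= scaler_sumr; congr (_ + _).
    by apply: eq_bigr => p _; rewrite /monom /= linearZ /= -scalerAl.
  + move=> /asboolP [s ->] /asboolP [t ->]; apply/asboolP.
    exists [seq (p.1 * q.1, p.2 ++ q.2) | p <- s, q <- t].
    rewrite big_allpairs_dep mulr_suml; apply: eq_bigr => p _.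
    by rewrite mulr_sumr; apply: eq_bigr => q _; rewrite monomM.
- apply/asboolP; exists [:: (a, [::])].
  by rewrite big_seq1 /monom /prod1 big_nil mulr1.
- apply/asboolP; exists [:: (1, [:: HForm x1])].
  by rewrite big_seq1 /monom /prod1 big_seq1 rmorph1 mul1r.
Qed.

Lemma monom_span_grade n (x : Om) : x \in grade Om n ->
  exists s, x = \sum_(p <- s | size p.2 == n) monom p.
Proof.
move=> xn; have [s xE] := monom_span x; exists s.
(* The bound exceeds [n] and every word length, so summing over degrees below [N] loses no term. *)
pose N := (maxn n (\max_(p <- s) size p.2)).+1.
have ltnN : (n < N)%N by rewrite ltnS leq_maxl.
(* The degree [j] component of the expansion minus [x]; the components sum to zero, and the claim is
   the vanishing of [f n]. *)
pose f (j : nat) : Om := \sum_(p <- s | size p.2 == j) monom p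
                         - (if j == n then x else 0).
have f_grade j : f j \in grade Om j.
  apply: rpredD; last first.
    by rewrite -scaleN1r rpredZ //; case: eqP => [->|] //; rewrite rpred0.
  by apply: rpred_sum => p /eqP <-; apply: monom_grade.
have f0 : \sum_(j < N) f j = 0.
  rewrite sumrB -big_mkcond /= [X in _ - X](big_pred1 (Ordinal ltnN)) //.
  apply/eqP; rewrite subr_eq0 xE; apply/eqP.
  under eq_bigr do rewrite big_mkcond.
  rewrite exchange_big /= [LHS]big_seq [RHS]big_seq; apply: eq_bigr => p ps.
  rewrite -big_mkcond /=.
  have ltpN : (size p.2 < N)%N.
    by rewrite ltnS leq_max (leq_bigmax_seq p ps) ?orbT.
  by rewrite (big_pred1 (Ordinal ltpN)) // => j; rewrite eq_sym.
have := grade_direct f_grade f0 ltnN.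
by rewrite /f eqxx => /eqP; rewrite subr_eq0 => /eqP.
Qed.

End Span.

(** * Identities for [nabla] *)

Section Nabla.

Variables (k : fieldType) (A : algType k) (Om : dga A).
Variables (Delta : {linear Om -> Om}) (br : {bilinear Om -> Om -> Om}).
Hypotheses (Delta_br_cocycle : cocycle Delta br) (br_cleft : cleft br).

Let nabla_linear w : linear (nabla br w).
Proof.
by move=> c x y; rewrite /nabla linearPr /= scalerDr !scalerA mulrC.
Qed.

Lemma nabla_suml (I : Type) (s : seq I) (P : pred I) (F : I -> Om) e :
  nabla br (\sum_(i <- s | P i) F i) e = \sum_(i <- s | P i) nabla br (F i) e.
Proof. by rewrite /nabla linear_sumlz scaler_sumr. Qed.

Lemma nabla_sumr w (I : Type) (s : seq I) (P : pred I) (F : I -> Om) :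
  nabla br w (\sum_(i <- s | P i) F i) = \sum_(i <- s | P i) nabla br w (F i).
Proof. by rewrite /nabla linear_sumr scaler_sumr. Qed.

Lemma nabla_degree i (w : Om) : w \in grade Om i ->
  has_degree (i%:Z - 1) (nabla br w).
Proof.
move=> wi n x xn; have := br_degree Delta_br_cocycle wi xn.
rewrite addrAC /nabla; case: (_ + _) => [m|m] /=; first exact: rpredZ.
(* In a negative degree [gradeZ] contains only 0. *)
by rewrite !inE => /eqP ->; rewrite scaler0.
Qed.

Lemma nabla_cocycle i (w e z : Om) : w \in grade Om i ->
  nabla br (w * e) z + nabla br w e * z
  = nabla br w (e * z) + (-1 : k) ^+ i *: (w * nabla br e z).
Proof.
move=> wi; rewrite /nabla -!scalerAl -!scalerAr -scalerDr.
rewrite (br_cocycle Delta_br_cocycle e z wi) scalerDr mulr_signZ.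
by rewrite !scalerA [in RHS]mulrC.
Qed.

Lemma nabla_inc (a : A) e : nabla br (inc a) e = 0.
Proof. by rewrite /nabla br_cleft scaler0. Qed.

Lemma nabla1l e : nabla br 1 e = 0.
Proof. by rewrite -(rmorph1 (@inc _ _ Om)) nabla_inc. Qed.

(** In the cocycle identity with first argument [inc a], cleftness kills the two terms where [nabla]
    is taken along [inc a]. *)
Lemma nabla_incl (a : A) w e : nabla br (inc a * w) e = inc a * nabla br w e.
Proof.
have := nabla_cocycle w e (inc_grade Om a).
by rewrite !nabla_inc mul0r addr0 add0r expr0 scale1r.
Qed.

(** With both other arguments equal to 1, the cocycle identity has [nabla br w 1] twice on the left
    and once on the right. *)
Lemma nabla_homog1 i (w : Om) : w \in grade Om i -> nabla br w 1 = 0.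
Proof.
move=> wi; have := nabla_cocycle 1 1 wi.
by rewrite !mulr1 nabla1l mulr0 scaler0 => /addrI.
Qed.

Lemma nabla1r (w : Om) : nabla br w 1 = 0.
Proof.
have [n [f [fn ->]]] := grade_span w.
by rewrite nabla_suml big1 // => i _; apply: nabla_homog1 (fn i).
Qed.

Lemma nabla_Leibnizator i (w e : Om) : w \in grade Om i ->
  2^-1 *: Leibnizator Delta w e
  = (dd (nabla br w e) + (-1) ^+ i * nabla br w (dd e)) + nabla br (dd w) e.
Proof.
move=> wi; rewrite (Delta_br Delta_br_cocycle e wi) /nabla !scalerDr linearZ /=.
by rewrite -scalerAr addrAC.
Qed.

Hypothesis Om_comm : graded_commutative Om.

(** This is the cocycle identity with [inc a] in the middle: that factor commutes with [w], so
    [nabla_incl] pulls it out of the left term. *)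
Lemma nabla_incr i (w : Om) (a : A) e : w \in grade Om i ->
  nabla br w (inc a * e) = inc a * nabla br w e + nabla br w (inc a) * e.
Proof.
move=> wi; have := nabla_cocycle (inc a) e wi.
by rewrite nabla_inc mulr0 scaler0 addr0 (inc_comm Om_comm _ wi) nabla_incl.
Qed.

Lemma jj_dform (jj : forall i, {additive tens Om i 1 -> Om}) i
    (w : hform Om i) (a : A) : regular br jj ->
  jj i (tensor w (dform Om a)) = nabla br w (inc a).
Proof.
move=> br_regular; have := jjE br_regular w 1 a.
have -> : lact 1 (dform Om a) = dform Om a.
  by apply: val_inj; rewrite /= rmorph1 mul1r.
by rewrite rmorph1 mulr1.
Qed.

(** * Consequences of the derivation property on one-forms *)

Hypothesis nabla_der : forall w : hform Om 1, graded_derivation 0 (nabla br w).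

(** In degree 0 the Leibniz rule carries no sign, so it extends additively to an inhomogeneous left
    factor. *)
Lemma nabla_der1 (w : hform Om 1) x y :
  nabla br w (x * y) = nabla br w x * y + x * nabla br w y.
Proof.
have [n [f [fn ->]]] := grade_span x; have [_ _ der] := nabla_der w.
rewrite mulr_suml !nabla_sumr !mulr_suml -big_split /=.
by apply: eq_bigr => i _; rewrite (der _ _ y (fn i)) mul0r expr0z scale1r.
Qed.

Lemma nabla_mul1 (w : hform Om 1) (p e : Om) :
  nabla br ((w : Om) * p) e = p * nabla br w e - (w : Om) * nabla br p e.
Proof.
have := nabla_cocycle p e (hformP w).
by rewrite nabla_der1 expr1 scaleN1r addrC -addrA => /addrI.
Qed.

Lemma nabla_prod1_der v n (x y : Om) : x \in grade Om n ->
  nabla br (prod1 v) (x * y) = nabla br (prod1 v) x * y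
    + (-1 : k) ^ (((size v)%:Z - 1) * n%:Z) *: (x * nabla br (prod1 v) y).
Proof.
move=> xn; elim: v => [|u v IHv].
  by rewrite /prod1 big_nil !nabla1l mul0r mulr0 scaler0 addr0.
rewrite prod1_cons !nabla_mul1 nabla_der1 IHv.
(* [c] is the sign for the tail [v] and [c'] the one for [u :: v]. Moving [prod1 v] past [x] gives
   [c']; moving [u] past [x] turns [c] into [c'], so both terms containing [nabla] of [y] carry the
   same sign. *)
set c := _ ^ (_ * _); set c' := _ ^ (_ * _).
have cE : c' = (-1) ^+ (size v * n) by rewrite /c' /= -addn1 PoszD addrK.
have cM : (-1) ^+ n * c = c'.
  (* The exponent of [c] is [- n] when [v] is empty, so the powers are added as integer powers of
     the nonzero scalar -1. *)
  rewrite cE /c -[(-1) ^+ n]/((-1) ^ n%:Z) -expfzDr ?oppr_eq0 ?oner_eq0 //.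
  by rewrite mulrBl mul1r addrC subrK.
have Px : prod1 v * x = c' *: (x * prod1 v).
  by rewrite (Om_comm (prod1_grade v) xn) cE mulr_signZ.
have ux : (u : Om) * x = (-1 : k) ^+ n *: (x * (u : Om)).
  by rewrite (Om_comm (hformP u) xn) mul1n mulr_signZ.
move: (nabla br u x) (nabla br u y) => a b.
move: (nabla br (prod1 v) x) (nabla br (prod1 v) y) => d g.
rewrite !mulrDr mulrBl mulrN -!scalerAr !mulrA Px ux -!scalerAl scalerA.
by rewrite [c * _]mulrC cM scalerBr opprD addrACA.
Qed.

Lemma nabla_graded_derivation : standard Om ->
  forall i (w : Om), w \in grade Om i ->
    graded_derivation (i%:Z - 1) (nabla br w).
Proof.
move=> Om_std i w wi; split; [exact: nabla_linear|exact: nabla_degree|].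
(* All monomials must have length [i], so that their Leibniz rules share one sign. *)
move=> n x y xn; have [s ->] := monom_span_grade Om_std Om_comm wi.
rewrite !nabla_suml mulr_suml mulr_sumr scaler_sumr -big_split /=.
apply: eq_bigr => p /eqP <-; rewrite /monom !nabla_incl.
rewrite (nabla_prod1_der _ _ xn) mulrDr -scalerAr !mulrA.
by rewrite (inc_comm Om_comm _ xn).
Qed.

Lemma nabla_prod m (w : 'I_m -> hform Om 1) e :
  nabla br (\prod_(i < m) (w i : Om)) e
  = \sum_(i < m) (-1) ^+ i
      * ((\prod_(l < m | l != i) (w l : Om)) * nabla br (w i) e).
Proof.
elim: m w => [|m IHm] w; first by rewrite !big_ord0 nabla1l.
rewrite !big_ord_recl nabla_mul1 IHm expr0 mul1r; congr (_ * _ + _).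
  (* Omitting index 0 leaves exactly the product of the tail. *)
  by rewrite [RHS]big_mkcond big_ord_recl /= mul1r.
rewrite mulr_sumr -sumrN; apply: eq_bigr => i _.
(* When a later index is omitted, the head factor [w ord0] remains and splits off; the shift of the
   index absorbs the minus sign of [nabla_mul1]. *)
rewrite [in RHS]big_mkcond big_ord_recl /= -big_mkcond /=.
rewrite !mulr_signZ -scalerAr exprS mulN1r scaleNr !mulrA.
by congr (- (_ *: (_ * _ * _))); apply: eq_bigl => l; rewrite (inj_eq lift_inj).
Qed.

End Nabla.

Theorem corollary3p17 (k : fieldType) (char_k : 2%N \notin [pchar k])
    (A : algType k) (Om : dga A) (Om_classical : classical_type Om)
    (Delta : {linear Om -> Om}) (br : {bilinear Om -> Om -> Om})
    (Delta_br_cocycle : cocycle Delta br) (br_cleft : cleft br)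
    (jj : forall i, {additive tens Om i 1 -> Om}) (br_regular : regular br jj) :
  [/\ forall (i : nat) (w : Om), w \in grade Om i ->
        has_degree (i%:Z - 1) (nabla br w),
      forall (a : A) (w e : Om),
        nabla br (inc a * w) e = inc a * nabla br w e,
      forall (i : nat) (w : hform Om i) (a : A) (e : Om),
        nabla br w (inc a * e)
        = inc a * nabla br w e + jj i (tensor w (dform Om a)) * e,
      (forall e : Om, nabla br 1 e = 0) /\ (forall w : Om, nabla br w 1 = 0) &
      forall (i : nat) (w e : Om), w \in grade Om i ->
        2^-1 *: Leibnizator Delta w e
        = (dd (nabla br w e) + (-1) ^+ i * nabla br w (dd e))
          + nabla br (dd w) e]
  /\ (metric_invertible jj ->
      (forall w : hform Om 1, graded_derivation 0 (nabla br w)) ->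
      (forall (i : nat) (w : Om), w \in grade Om i ->
         graded_derivation (i%:Z - 1) (nabla br w)) /\
      (forall (m : nat) (w : 'I_m -> hform Om 1) (e : Om),
         nabla br (\prod_(i < m) (w i : Om)) e
         = \sum_(i < m) (-1) ^+ i
             * ((\prod_(l < m | l != i) (w l : Om)) * nabla br (w i) e))).
Proof.
have [Om_std Om_comm _] := Om_classical.
split; last first.
  move=> _ nabla_der; split.
    exact: (nabla_graded_derivation Delta_br_cocycle).
  exact: (nabla_prod Delta_br_cocycle).
split.
- exact: (nabla_degree Delta_br_cocycle).
- exact: (nabla_incl Delta_br_cocycle).
- move=> i w a e; rewrite (jj_dform _ _ br_regular).
  exact: (nabla_incr Delta_br_cocycle br_cleft Om_comm _ _ (hformP w)).
- split; first exact: nabla1l.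
  exact: (nabla1r Delta_br_cocycle).
- exact: (nabla_Leibnizator Delta_br_cocycle).
Qed.
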